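(* Let $J\subseteq\mathbb{Z}[x_0,\dots,x_n]$ be a saturated strongly stable ideal. Then, for every $s>0$ and for any noetherian ring $A$, $\underline{\mathbf{Mf}}_{J_{\ge s-1}}(A)\subseteq\underline{\mathbf{Mf}}_{J_{\ge s}}(A)$ (where ideals are identified with the subschemes of $\mathbb{P}^n_A$ they define). More precisely, (i) if $J$ has no minimal generators of degree $s+1$ divisible by the variable $x_1$ or $J_{\ge s-1}=J_{\ge s}$, then $\underline{\mathbf{Mf}}_{J_{\ge s-1}}=\underline{\mathbf{Mf}}_{J_{\ge s}}$; (ii) otherwise, $\underline{\mathbf{Mf}}_{J_{\ge s-1}}$ is a proper closed subfunctor of $\underline{\mathbf{Mf}}_{J_{\ge s}}$.
   Context: All rings are commutative, noetherian, with unit. $A[\mathbf{x}]=A[x_0,\dots,x_n]$ with variables ordered $x_0<\dots<x_n$; $\mathbb{P}^n_A=\operatorname{Proj}A[\mathbf{x}]$. ${}_A\langle H\rangle$ is the $A$-module generated by $H$. A monomial ideal $J$ is strongly stable if for every monomial $x^\alpha\in J$, every $x_j\mid x^\alpha$ and every $x_i>x_j$, one has $\frac{x_i}{x_j}x^\alpha\in J$. $\mathcal{N}(J)$ is the set of monomials not in $J$; the same letter $J$ denotes the monomial ideal with the same monomials in any $A[\mathbf{x}]$. $I_{\ge m}$ is the truncation of a homogeneous ideal $I$, i.e. the ideal of elements of $I$ all of whose homogeneous components have degree $\ge m$. Minimal generators are those of the minimal monomial basis. For a strongly stable ideal $J'$, the marked functor $\underline{\mathbf{Mf}}_{J'}$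 (noetherian rings to sets) sends $A$ to $\{\text{homogeneous ideals } I\subseteq A[\mathbf{x}]\mid A[\mathbf{x}]=I\oplus{}_A\langle\mathcal{N}(J')\rangle\}$ and $A\to B$ to $I\mapsto I\otimes_A B\subseteq B[\mathbf{x}]$. Identification convention: for truncations $J_{\ge m}$ of a saturated strongly stable ideal $J$, distinct elements of $\underline{\mathbf{Mf}}_{J_{\ge m}}(A)$ define distinct subschemes of $\mathbb{P}^n_A$. Elements $I\in\underline{\mathbf{Mf}}_{J_{\ge m}}(A)$ and $I'\in\underline{\mathbf{Mf}}_{J_{\ge m'}}(A)$ are identified when $\operatorname{Proj}A[\mathbf{x}]/I=\operatorname{Proj}A[\mathbf{x}]/I'$ in $\mathbb{P}^n_A$, i.e. when $I_{\ge t}=I'_{\ge t}$ for $t\gg0$. Inclusion, equality and (proper, closed) subfunctor are understood under this identification. *)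

(* Defs.v *)
From HB Require Import structures.
From mathcomp Require Import all_boot all_order all_algebra.
From mathcomp Require Export mpoly.

Set Implicit Arguments.
Unset Strict Implicit.
Unset Printing Implicit Defensive.

Import GRing.Theory.
Local Open Scope ring_scope.

Definition lspan (R : nzRingType) (V : lmodType R) (H : V -> Prop) (v : V) :=
  exists (k : nat) (c : 'I_k -> R) (e : 'I_k -> V),
    (forall i, H (e i)) /\ v = \sum_i c i *: e i.

Definition direct_sum (V : zmodType) (P Q : V -> Prop) :=
  (forall v, exists p q, [/\ P p, Q q & v = p + q]) /\
  (forall v, P v -> Q v -> v = 0).

Definition is_ideal (R : comNzRingType) (I : R -> Prop) :=
  [/\ I 0, forall x y, I x -> I y -> I (x + y) & forall a x, I x -> I (a * x)].

Definition ideal_gen (R : comNzRingType) (H : R -> Prop) : R -> Prop :=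
  @lspan R R^o H.

Definition noetherian (R : comNzRingType) :=
  forall I : R -> Prop, is_ideal I ->
    exists s : seq R, forall x, I x <-> ideal_gen (fun y => y \in s) x.

Section PolynomialIdeals.
Variables (n : nat) (A : comNzRingType).
Implicit Types I : {mpoly A[n.+1]} -> Prop.

Definition homogeneous I := forall f d, I f -> I (pihomog mdeg d f).

Definition truncge (m : nat) I : {mpoly A[n.+1]} -> Prop := fun f =>
  I f /\ forall d, pihomog mdeg d f != 0 -> (m <= d)%N.

(* Proj A[x]/I = Proj A[x]/I' as closed subschemes of P^n_A. *)
Definition same_proj I I' :=
  exists t0, forall t, (t0 <= t)%N ->
    forall f, truncge t I f <-> truncge t I' f.

(* The power (x_0, ..., x_n)^k of the irrelevant ideal is generated by the
   monomials of degree k, so this says I : (x_0, ..., x_n)^oo is contained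
   in I. *)
Definition saturated I :=
  forall f, (exists k, forall m : 'X_{1..n.+1}, mdeg m = k -> I ('X_[m] * f)) ->
    I f.

Definition monomial_ideal I :=
  exists M : 'X_{1..n.+1} -> Prop,
    forall f, I f <-> ideal_gen (fun g => exists2 m, M m & g = 'X_[m]) f.

Definition strongly_stable I :=
  monomial_ideal I /\
  forall (m : 'X_{1..n.+1}) (i j : 'I_n.+1),
    I 'X_[m] -> (0 < m j)%N -> (j < i)%N -> I 'X_[(m - U_(j) + U_(i))%MM].

Definition min_generator I (m : 'X_{1..n.+1}) :=
  I 'X_[m] /\
  forall m' : 'X_{1..n.+1}, (m' <= m)%MM -> I 'X_[m'] -> m' = m.

(* When n = 0 there is no variable x_1, and no such generator. *)
Definition has_x1_generator I (d : nat) :=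
  exists m : 'X_{1..n.+1}, [/\ min_generator I m, mdeg m = d &
    exists2 i : 'I_n.+1, i = 1%N :> nat & (0 < m i)%N].

End PolynomialIdeals.

(* I (x)_A B, as the image of I (x)_A B -> A[x] (x)_A B = B[x]. *)
Definition base_change (n : nat) (A B : comNzRingType) (phi : {rmorphism A -> B})
    (I : {mpoly A[n.+1]} -> Prop) : {mpoly B[n.+1]} -> Prop :=
  lspan (fun g => exists2 f, I f & g = map_mpoly phi f).

(* Families of ideals of A[x], A varying; the transition maps are always
   [base_change], and ideals are taken up to [same_proj]. *)
Definition ideal_family (n : nat) :=
  forall A : comNzRingType, ({mpoly A[n.+1]} -> Prop) -> Prop.

(* The monomial ideal J is given over Z; only its monomials matter here, so
   the same J serves over every A. *)
Definition Mf (n : nat) (J : {mpoly int[n.+1]} -> Prop) : ideal_family n :=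
  fun A I => [/\ is_ideal I, homogeneous I &
    direct_sum I
      (lspan (fun g => exists2 m : 'X_{1..n.+1}, ~ J 'X_[m] & g = 'X_[m]))].

Section Subfunctors.
Variable n : nat.
Implicit Types F G : ideal_family n.

Definition proj_mem F (A : comNzRingType) (I : {mpoly A[n.+1]} -> Prop) :=
  exists2 I', F A I' & same_proj I I'.

Definition included G F (A : comNzRingType) :=
  forall I : {mpoly A[n.+1]} -> Prop, G A I -> proj_mem F I.

(* The last two clauses say that G(phi) is the restriction of F(phi). *)
Definition subfunctor G F :=
  forall A : comNzRingType, noetherian A ->
    included G F A /\
    forall (B : comNzRingType) (phi : {rmorphism A -> B}), noetherian B ->
      (forall I, G A I -> G B (base_change phi I)) /\
      (forall I I', G A I -> F A I' -> same_proj I I' ->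
         same_proj (base_change phi I) (base_change phi I')).

Definition eq_functor G F := subfunctor G F /\ subfunctor F G.

(* For every A and every element I of F(A), the locus of Spec A where I
   belongs to G is a closed subscheme Spec A/a. *)
Definition closed_subfunctor G F :=
  subfunctor G F /\
  forall A : comNzRingType, noetherian A ->
  forall I : {mpoly A[n.+1]} -> Prop, F A I ->
    exists2 a : A -> Prop, is_ideal a &
      forall (B : comNzRingType) (phi : {rmorphism A -> B}), noetherian B ->
        proj_mem G (base_change phi I) <-> (forall x, a x -> phi x = 0).

Definition proper_closed_subfunctor G F :=
  closed_subfunctor G F /\
  exists2 A : comNzRingType, noetherian A & ~ included F G A.

End Subfunctors.

(* Main.v *)
Require Import Defs.
From HB Require Import structures.
From mathcomp Require Import all_boot all_order all_algebra.
From mathcomp Require Import ssrcomplements zify.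
From Stdlib Require Import ClassicalEpsilon.

Set Implicit Arguments.
Unset Strict Implicit.
Unset Printing Implicit Defensive.

Import GRing.Theory.
Local Open Scope ring_scope.

(* Over any ring A, a marked ideal is the kernel of its normal form map, the
   A-linear projection onto the span of N(J); base change acts on the normal
   forms of monomials coefficientwise.  As x_0 is not a zero divisor modulo J,
   normal forms commute with multiplication by x_0 in the degrees where the
   truncation is J; hence the subscheme determines the normal forms in those
   degrees.  An ideal I marked over J_{>=s} thus belongs to the functor of
   J_{>=s-1} exactly when (I_s : x_0) is a complement of N(J) in degree s-1,
   that is, when the normal form of x_0 m is divisible by x_0 for every monomial
   m of J of degree s-1.  This is the vanishing of finitely many coefficients,
   whence a closed condition.  It holds automatically when no minimal generator
   of degree s+1 involves x_1, by reducing x_0 x_1 m in two ways; otherwise such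
   a generator x_1 x^b gives a deformation violating it. *)

(** * Linear extension of maps on monomials, and division by a variable *)

Section LinearExtension.
Variables (k : nat) (A : comNzRingType).
Implicit Types (p q : {mpoly A[k]}) (h : 'X_{1..k} -> {mpoly A[k]}).

Definition lext h p : {mpoly A[k]} := \sum_(m <- msupp p) p@_m *: h m.

(** A common degree bound makes the index set independent of [p], so that sums for different
    polynomials can be compared termwise. *)
Lemma lextwE h p w : (msize p <= w)%N ->
  lext h p = \sum_(m : 'X_{1..k < w}) p@_m *: h m.
Proof.
move=> lt_pw; pose I : subFinType _ := 'X_{1..k < w}.
rewrite /lext (big_mksub I) //=; first last.
- by move=> x /msize_mdeg_lt /leq_trans; apply.
- exact: msupp_uniq.
by rewrite big_rmcond //= => i /memN_msupp_eq0 ->; rewrite scale0r.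
Qed.

Lemma lext_is_linear h : linear (lext h).
Proof.
move=> c p q; pose w := (msize p + msize q + msize (c *: p + q))%N.
rewrite !(@lextwE h _ w) ?/w; try lia.
rewrite scaler_sumr -big_split /=; apply: eq_bigr => m _.
by rewrite mcoeffD mcoeffZ scalerDl scalerA.
Qed.

HB.instance Definition _ h :=
  GRing.isLinear.Build A {mpoly A[k]} {mpoly A[k]} _ (lext h)
    (lext_is_linear h).

Lemma lextX h m : lext h 'X_[m] = h m.
Proof. by rewrite /lext msuppX big_seq1 mcoeffX eqxx scale1r. Qed.

Lemma lextZ h c p : lext h (c *: p) = c *: lext h p.
Proof. exact: linearZ. Qed.

Lemma eq_lext h h' p : {in msupp p, h =1 h'} -> lext h p = lext h' p.
Proof. by move=> eq_h; apply: eq_big_seq => m /eq_h ->. Qed.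

Lemma msupp_lext h p u :
  u \in msupp (lext h p) -> exists2 m, m \in msupp p & u \in msupp (h m).
Proof.
move=> /msupp_sum_le /flattenP[_ /mapP[m + ->] /msuppZ_le u_m].
by rewrite mem_filter => m_p; exists m.
Qed.

Lemma lext_id h p : {in msupp p, forall m, h m = 'X_[m]} -> lext h p = p.
Proof.
by move=> hX; rewrite [RHS]mpolyE; apply: eq_big_seq => m /hX ->.
Qed.

Lemma sub_lextE h p :
  p - lext h p = \sum_(m <- msupp p) p@_m *: ('X_[m] - h m).
Proof.
rewrite {1}[p]mpolyE /lext -sumrB; apply: eq_bigr => m _.
by rewrite scalerBr.
Qed.

Lemma mcoeff_mulX i p v :
  ('X_i * p)@_v = if (0 < v i)%N then p@_((v - U_(i))%MM) else 0.
Proof.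
rewrite -commr_mpolyX; case: ifP => [v_i | v_i].
  by rewrite -{1}(@submK _ U_(i)%MM v) ?lep1mP -?lt0n // addmC mcoeffMX.
apply/eqP; rewrite mcoeff_eq0 (perm_mem (msuppMX _ _)); apply/mapP=> -[u _].
by move=> v_u; rewrite v_u mnmDE mnm1E eqxx in v_i.
Qed.

Lemma mulXI i p q : 'X_i * p = 'X_i * q -> p = q.
Proof.
move=> eq_pq; apply/mpolyP => m; have := congr1 (mcoeff (m + U_(i))%MM) eq_pq.
by rewrite !mcoeff_mulX mnmDE mnm1E eqxx addn1 /= addmK.
Qed.

Lemma msupp_mulX i p v :
  v \in msupp ('X_i * p) -> exists2 u, u \in msupp p & v = (u + U_(i))%MM.
Proof.
rewrite !mcoeff_msupp mcoeff_mulX; case: ifP => [v_i nz | _ /eqP//].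
exists (v - U_(i))%MM; first by rewrite mcoeff_msupp.
by rewrite submK // lep1mP -lt0n.
Qed.

(** Monomials not divisible by the variable go to 0, so this is a true quotient only when the
    variable divides the whole support. *)
Definition quoX i p : {mpoly A[k]} :=
  lext (fun u => if (0 < u i)%N then 'X_[(u - U_(i))%MM] else 0) p.

Lemma mcoeff_quoX i p v : (quoX i p)@_v = p@_((v + U_(i))%MM).
Proof.
rewrite {2}[p]mpolyE /quoX /lext !raddf_sum /=; apply: eq_bigr => u _.
rewrite !mcoeffZ mcoeffX; case: ifP => [u_i | u_i].
  rewrite mcoeffX; congr (_ * _%:R).
  rewrite -{2}(@submK _ U_(i)%MM u) ?lep1mP -?lt0n //.
  by rewrite eqm_add2r.
rewrite mcoeff0; case: eqP => // u_v.
by rewrite u_v mnmDE mnm1E eqxx addn1 in u_i.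
Qed.

Lemma mulX_quoX i p :
  {in msupp p, forall u : 'X_{1..k}, (0 < u i)%N} -> 'X_i * quoX i p = p.
Proof.
move=> p_i; apply/mpolyP => v; rewrite mcoeff_mulX; case: ifP => v_i.
  by rewrite mcoeff_quoX submK // lep1mP -lt0n.
by apply/esym/memN_msupp_eq0; apply/negP => /p_i; rewrite v_i.
Qed.

End LinearExtension.

Lemma lext_map k (A B : comNzRingType) (phi : {rmorphism A -> B})
    (h : 'X_{1..k} -> {mpoly A[k]}) p :
  lext (fun m => map_mpoly phi (h m)) (map_mpoly phi p) =
  map_mpoly phi (lext h p).
Proof.
rewrite {1}[p]mpolyE /(lext h p) !(raddf_sum (map_mpoly phi)) raddf_sum /=.
apply: eq_bigr => m _.
by rewrite !map_mpolyZ map_mpolyX lextZ lextX.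
Qed.

(** * Homogeneous components, truncations and spans *)

Lemma mcoeff_pihomog k (A : comNzRingType) d (p : {mpoly A[k]}) u :
  (pihomog mdeg d p)@_u = if mdeg u == d then p@_u else 0.
Proof.
rewrite pihomogE raddf_sum /= [in RHS](mpolyE p) raddf_sum /= big_mkcond /=.
have [u_d | u_d] := eqVneq (mdeg u) d.
  apply: eq_bigr => m _; case: eqP => // m_d; rewrite mcoeffZ mcoeffX.
  by case: eqP => [mu | _]; [case: m_d; rewrite mu | rewrite mulr0].
apply: big1 => m _; case: eqP => // m_d; rewrite mcoeffZ mcoeffX.
by case: eqP => [mu | _]; [rewrite -mu m_d eqxx in u_d | rewrite mulr0].
Qed.

Lemma truncgeP n (A : comNzRingType) t (I : {mpoly A[n.+1]} -> Prop) f :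
  truncge t I f <->
  I f /\ {in msupp f, forall u : 'X_{1..n.+1}, (t <= mdeg u)%N}.
Proof.
split=> -[If hf]; split=> //.
  move=> u u_f; apply: hf; apply/eqP => /(congr1 (mcoeff u)).
  by rewrite mcoeff_pihomog eqxx mcoeff0; apply/eqP; rewrite -mcoeff_msupp.
move=> d nz; have [u u_d] : exists u, (pihomog mdeg d f)@_u != 0.
  apply: NNPP => none; move/eqP: nz; apply; apply/mpolyP => u.
  by rewrite mcoeff0; apply/eqP/negPn/negP => nz; apply: none; exists u.
move: u_d; rewrite mcoeff_pihomog; case: (eqVneq (mdeg u) d) => [<- | _ /eqP//].
by rewrite -mcoeff_msupp => /hf.
Qed.

Lemma lspan_sum (R : nzRingType) (V : lmodType R) (H : V -> Prop)
    (T : eqType) (s : seq T) (c : T -> R) (e : T -> V) :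
  {in s, forall x, H (e x)} -> lspan H (\sum_(x <- s) c x *: e x).
Proof.
move=> He; exists (size s), (c \o tnth (in_tuple s)), (e \o tnth (in_tuple s)).
split; first by move=> i; apply: He; apply: mem_tnth.
by rewrite big_tnth.
Qed.

(* [h m] plays the role of the normal form of the monomial [m] modulo a marked
   ideal, [P] being the set of monomials that are not in normal form; the
   third clause says that the kernel of the normal form map is an ideal. *)
Definition marked n (A : comNzRingType) (P : pred 'X_{1..n.+1})
    (h : 'X_{1..n.+1} -> {mpoly A[n.+1]}) :=
  [/\ forall m, ~~ P m -> h m = 'X_[m],
      forall m u, u \in msupp (h m) -> ~~ P u /\ mdeg u = mdeg m &
      forall m i, h (m + U_(i))%MM = lext h ('X_i * h m)].

(** * Normal forms modulo a marked ideal *)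

Section Marked.
Variables (n : nat) (A : comNzRingType) (P : pred 'X_{1..n.+1}).
Variables (h : 'X_{1..n.+1} -> {mpoly A[n.+1]}).
Hypothesis mh : marked P h.

Lemma lext_normal p : {in msupp p, forall u, ~~ P u} -> lext h p = p.
Proof. by case: mh => hX _ _ Np; apply: lext_id => u /Np /hX. Qed.

Lemma normal_lext p : {in msupp (lext h p), forall u, ~~ P u}.
Proof. by case: mh => _ hN _ u /msupp_lext[m _ /hN[]]. Qed.

Lemma lext_idem p : lext h (lext h p) = lext h p.
Proof. exact/lext_normal/normal_lext. Qed.

Lemma lext_mulX i p : lext h ('X_i * p) = lext h ('X_i * lext h p).
Proof.
case: mh => _ _ hM; rewrite {1}[p]mpolyE /(lext h p) !mulr_sumr !raddf_sum /=.
apply: eq_bigr => m _; rewrite -!scalerAr !lextZ; congr (_ *: _).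
by rewrite -hM -mpolyXD lextX addmC.
Qed.

(** The multipliers that preserve the kernel contain the variables and are closed under products and
    linear combinations. *)
Lemma ker_mul a f : lext h f = 0 -> lext h (a * f) = 0.
Proof.
pose K (b : {mpoly A[n.+1]}) := forall g, lext h g = 0 -> lext h (b * g) = 0.
move: f; have KM b c : K b -> K c -> K (b * c).
  by move=> Kb Kc g hg; rewrite -mulrA; apply/Kb/Kc.
have K1 : K 1 by move=> g; rewrite mul1r.
have KX i : K 'X_i by move=> g hg; rewrite lext_mulX hg mulr0 raddf0.
rewrite -/(K a) [a]mpolyE; elim/big_ind: _ => [g _|b c Kb Kc g hg|m _].
- by rewrite mul0r raddf0.
- by rewrite mulrDl raddfD /= Kb // Kc // addr0.
have KXm : K 'X_[m].
  rewrite mpolyXE_id; elim/big_ind: _ => // i _.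
  elim: (m i) => [|e IHe]; first by rewrite expr0.
  by rewrite exprS; apply: KM.
by move=> g hg; rewrite -scalerAl lextZ KXm // scaler0.
Qed.

Lemma lext_pihomog d f : lext h (pihomog mdeg d f) = pihomog mdeg d (lext h f).
Proof.
case: mh => _ hN _.
rewrite {1}[f]mpolyE /(lext h f) !(raddf_sum (pihomog mdeg d)).
rewrite (raddf_sum (lext h)) /=; apply: eq_bigr => m _.
rewrite !linearZ /=; congr (_ *: _); rewrite pihomogX.
apply/mpolyP => u; rewrite mcoeff_pihomog; case: (eqVneq (mdeg m) d) => m_d.
  rewrite lextX; case: eqP => // u_d; apply/memN_msupp_eq0/negP => /hN[_].
  by rewrite m_d.
rewrite raddf0 mcoeff0; case: eqP => // u_d; apply/esym/memN_msupp_eq0.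
by apply/negP => /hN[_]; rewrite u_d => /esym/eqP; rewrite (negPf m_d).
Qed.

End Marked.

(** [h m] is the component of ['X_[m]] in the normal part; directness of the sum makes [I] the
    kernel of [lext h]. Conversely, [lext h] is idempotent and its kernel is an ideal, which gives
    the splitting. *)
Lemma MfP n (K : {mpoly int[n.+1]} -> Prop) (P : pred 'X_{1..n.+1})
    (A : comNzRingType) (I : {mpoly A[n.+1]} -> Prop) :
  (forall m, K 'X_[m] <-> P m) ->
  Mf K I <->
  exists2 h, marked P h & forall f, I f <-> lext h f = 0.
Proof.
move=> KP; rewrite /Mf; set N := lspan _.
have NP q : N q <-> {in msupp q, forall u, ~~ P u}.
  split=> [[k [c [e [He ->]]]] u | Nq].
    move=> /msupp_sum_le /flattenP[_ /mapP[i _ ->] /msuppZ_le].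
    have [m Km ->] := He i; rewrite msuppX inE => /eqP ->.
    by apply/negP => /KP.
  rewrite [q]mpolyE; apply: lspan_sum => m /Nq Pm; exists m => //.
  by move/KP; rewrite (negPf Pm).
split=> [[[I0 ID IM] Ih [dir1 dir2]] | [h mh Ih]]; last first.
  split.
  - split; first by apply/Ih; rewrite raddf0.
      by move=> f g /Ih hf /Ih hg; apply/Ih; rewrite raddfD /= hf hg addr0.
    by move=> a f /Ih hf; apply/Ih; apply: ker_mul mh _ _ hf.
  - by move=> f d /Ih hf; apply/Ih; rewrite (lext_pihomog mh) hf raddf0.
  - split=> [v | v /Ih hv /NP Nv].
      exists (v - lext h v), (lext h v); split; last by rewrite subrK.
        by apply/Ih; rewrite raddfB /= (lext_idem mh) subrr.
      exact/NP/normal_lext.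
    by rewrite -(lext_normal mh Nv).
have nf m : {q | N q /\ I ('X_[m] - q)}.
  apply: constructive_indefinite_description.
  by have [p [q [Ip Nq ->]]] := dir1 'X_[m]; exists q; rewrite addrK.
pose h m := sval (nf m).
have hN m : N (h m) by case: (svalP (nf m)).
have hI m : I ('X_[m] - h m) by case: (svalP (nf m)).
have IZ c f : I f -> I (c *: f) by move=> If; rewrite -mul_mpolyC; apply: IM.
have IB f g : I f -> I g -> I (f - g).
  by move=> If Ig; rewrite -scaleN1r; apply: ID => //; apply: IZ.
have Ilext f : I (f - lext h f).
  by rewrite sub_lextE; elim/big_ind: _ => // m _; apply: IZ.
have Nlext f : N (lext h f).
  by apply/NP => u /msupp_lext[m _]; move: u; apply/NP.
have NB f g : N f -> N g -> N (f - g).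
  move=> /NP Nf /NP Ng; apply/NP => u /msuppB_le.
  by rewrite mem_cat => /orP[/Nf | /Ng].
have Ih0 f : I f <-> lext h f = 0.
  split=> [If | hf]; last by rewrite -[f]subr0 -hf.
  apply: dir2 => //; rewrite -[lext h f](subKr f); exact: IB.
exists h => //; split.
- move=> m Pm; apply/esym/subr0_eq; apply: dir2 => //; apply: NB => //.
  by apply/NP => u; rewrite msuppX inE => /eqP ->.
- move=> m u u_h; split; first by apply/NP: (u) u_h.
  apply/eqP/negPn/negP => u_m; move: u_h; rewrite mcoeff_msupp => /eqP[].
  (* As [mdeg u] differs from [mdeg m], this component of ['X_[m] - h m] is that of [- h m]: it lies
     both in [I] and in the normal part, hence vanishes. *)
  have := Ih _ (mdeg u) (hI m); rewrite raddfB /= pihomogX.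
  rewrite eq_sym (negPf u_m) sub0r => /(IZ (-1)); rewrite scaleN1r opprK.
  move=> /dir2 /(_ _) h0; have : (pihomog mdeg (mdeg u) (h m))@_u = 0.
    rewrite h0 ?mcoeff0 //; apply/NP => v; rewrite mcoeff_msupp mcoeff_pihomog.
    by case: (eqVneq (mdeg v) (mdeg u)) => [_ | _ /eqP//];
      rewrite -mcoeff_msupp; apply/NP: (v).
  by rewrite mcoeff_pihomog eqxx.
- move=> m i; have /Ih0 := IM 'X_i _ (hI m).
  by rewrite mulrBr raddfB /= -mpolyXD lextX addmC => /subr0_eq.
Qed.

Lemma marked_map n (A B : comNzRingType) (phi : {rmorphism A -> B})
    (P : pred 'X_{1..n.+1}) (h : 'X_{1..n.+1} -> {mpoly A[n.+1]}) :
  marked P h -> marked P (fun m => map_mpoly phi (h m)).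
Proof.
case=> hX hN hM; split.
- by move=> m /hX ->; rewrite map_mpolyX.
- move=> m u u_h; apply: hN; move: u_h; rewrite !mcoeff_msupp
  mcoeff_map_mpoly.
  by apply: contra => /eqP ->; rewrite raddf0.
- by move=> m i; rewrite hM -lext_map rmorphM /= map_mpolyX.
Qed.

(** [g] minus its normal form is a [B]-combination of the images of the elements ['X_[m] - h m] of
    [I]. *)
Lemma base_changeP n (A B : comNzRingType) (phi : {rmorphism A -> B})
    (P : pred 'X_{1..n.+1}) (h : 'X_{1..n.+1} -> {mpoly A[n.+1]}) I :
  marked P h -> (forall f, I f <-> lext h f = 0) ->
  forall g, base_change phi I g <->
    lext (fun m => map_mpoly phi (h m)) g = 0.
Proof.
move=> mh Ih g; split=> [[k [c [e [He ->]]]] | hg].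
  rewrite raddf_sum big1 // => i _ /=; rewrite lextZ.
  by have [f /Ih hf ->] := He i; rewrite lext_map hf rmorph0 scaler0.
rewrite -[g]subr0 -hg sub_lextE; apply: lspan_sum => m _.
exists ('X_[m] - h m); last by rewrite rmorphB /= map_mpolyX.
by apply/Ih; rewrite raddfB /= -(lextX h m) (lext_idem mh) subrr.
Qed.

Definition mtrunc n s (P : pred 'X_{1..n.+1}) : pred 'X_{1..n.+1} :=
  fun m => P m && (s <= mdeg m)%N.

(* For the monomials of a saturated strongly stable ideal, the last clause
   says that [x_0] is not a zero divisor modulo the ideal. *)
Definition sat_stable n (P : pred 'X_{1..n.+1}) :=
  [/\ forall m i, P m -> P (m + U_(i))%MM,
      forall m (i j : 'I_n.+1), P m -> (0 < m j)%N -> (j < i)%N ->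
        P (m - U_(j) + U_(i))%MM &
      forall m, P (m + U_(ord0))%MM -> P m].

(** * Truncations of a saturated strongly stable set of monomials *)

Section SatStable.
Variables (n : nat) (P : pred 'X_{1..n.+1}).
Hypothesis sP : sat_stable P.

Section OneIdeal.
Variables (A : comNzRingType) (s : nat).
Variables (h : 'X_{1..n.+1} -> {mpoly A[n.+1]}).
Hypothesis mh : marked (mtrunc s P) h.
Implicit Types p : {mpoly A[n.+1]}.

Lemma marked_notin m u :
  (s <= mdeg m)%N -> u \in msupp (h m) -> ~~ P u /\ mdeg u = mdeg m.
Proof.
case: mh => _ hN _ s_m /hN[+ u_m].
by rewrite /mtrunc u_m s_m andbT.
Qed.

Lemma lext_notin p : {in msupp p, forall u, ~~ P u} -> lext h p = p.
Proof.
by move=> Np; apply: (lext_normal mh) => u /Np; rewrite /mtrunc => /negPf ->.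
Qed.

(** In degrees at least [s] a normal form avoids all of [P]; by the last clause of [sat_stable] so
    does its product with x_0, which is thus already reduced. *)
Lemma lext_mulX0 p : {in msupp p, forall u : 'X_{1..n.+1}, s <= mdeg u}%N ->
  lext h ('X_ord0 * p) = 'X_ord0 * lext h p.
Proof.
case: sP => _ _ P0 sp; rewrite (lext_mulX mh); apply: lext_notin => v.
move=> /msupp_mulX[u /msupp_lext[m /sp s_m u_m] ->].
have [Pu _] := marked_notin s_m u_m.
by apply: contra Pu => /P0.
Qed.

Lemma lext_mulX0n e p : {in msupp p, forall u : 'X_{1..n.+1}, s <= mdeg u}%N ->
  lext h ('X_ord0 ^+ e * p) = 'X_ord0 ^+ e * lext h p.
Proof.
move=> sp; suff [] : lext h ('X_ord0 ^+ e * p) = 'X_ord0 ^+ e * lext h p /\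
  {in msupp ('X_ord0 ^+ e * p), forall u : 'X_{1..n.+1}, s <= mdeg u}%N by [].
elim: e => [|e [IHe IHs]]; first by rewrite expr0 !mul1r.
rewrite exprS -!mulrA lext_mulX0 // IHe; split=> // u /msupp_mulX[v /IHs + ->].
by rewrite mdegD; lia.
Qed.

End OneIdeal.

(** A power of x_0 carries ['X_[m] - h m] into degrees where the two ideals agree; reduction by [h']
    commutes with that power, which then cancels and leaves [h m = h' m]. *)
Lemma same_proj_nf (A : comNzRingType) a b h h'
    (I I' : {mpoly A[n.+1]} -> Prop) :
  marked (mtrunc a P) h -> (forall f, I f <-> lext h f = 0) ->
  marked (mtrunc b P) h' -> (forall f, I' f <-> lext h' f = 0) ->
  same_proj I I' <-> forall m, (maxn a b <= mdeg m)%N -> h m = h' m.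
Proof.
move=> mh Ih mh' Ih'; split=> [[t0 II'] m | eq_h]; last first.
  exists (maxn a b) => t le_t f; rewrite !truncgeP Ih Ih'.
  by split=> -[hf tf]; split=> //; rewrite -hf;
    apply: eq_lext => m /tf t_m; rewrite eq_h // (leq_trans le_t).
rewrite geq_max => /andP[a_m b_m]; set f := 'X_[m] - h m.
have deg_f : {in msupp f, forall u, mdeg u = mdeg m}.
  move=> u /msuppB_le; rewrite mem_cat msuppX inE => /orP[/eqP -> // |].
  by case/(marked_notin mh a_m).
have hf : lext h f = 0.
  by rewrite raddfB /= -(lextX h) (lext_idem mh) subrr.
have : truncge t0 I ('X_ord0 ^+ t0 * f).
  apply/truncgeP; split.
    apply/Ih; rewrite (lext_mulX0n mh) ?hf ?mulr0 // => u /deg_f -> //.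
  move=> u; rewrite mpolyXn -commr_mpolyX (perm_mem (msuppMX _ _)).
  by case/mapP => v _ ->; rewrite mdegD mdegMn mdeg1; lia.
move=> /(II' _ (leqnn _)) /truncgeP[/Ih' + _].
rewrite (lext_mulX0n mh') => [|u /deg_f -> //].
have X0I e p : 'X_ord0 ^+ e * p = 0 :> {mpoly A[n.+1]} -> p = 0.
  elim: e => [|e IHe]; first by rewrite mul1r.
  by rewrite exprS -mulrA -[RHS](mulr0 'X_ord0) => /mulXI.
move=> /X0I; rewrite raddfB /= lextX (lext_notin mh') => [/subr0_eq -> //|u].
by case/(marked_notin mh a_m).
Qed.

(** Monomials of degree at most [r] become normal; since reduction preserves degree, the higher
    degrees are untouched. *)
Lemma marked_mtruncS (A : comNzRingType) r (h : _ -> {mpoly A[n.+1]}) :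
  marked (mtrunc r P) h ->
  marked (mtrunc r.+1 P) (fun m => if (r < mdeg m)%N then h m else 'X_[m]).
Proof.
case=> hX hN hM; set h' := fun m => _.
have h'X m : ~~ (r < mdeg m)%N -> h' m = 'X_[m] by rewrite /h' => /negPf ->.
split=> [m | m u | m i].
- rewrite negb_and /h' => Pm; case: ifP => // r_m; apply: hX.
  by rewrite r_m orbF in Pm; rewrite /mtrunc negb_and Pm.
- rewrite /h'; case: ifP => [r_m /hN[Nu u_m] | r_m].
    split=> //; rewrite /mtrunc u_m r_m andbT.
    by move: Nu; rewrite /mtrunc u_m ltnW // andbT.
  by rewrite msuppX inE => /eqP ->; rewrite /mtrunc r_m andbF.
- have [r_m | r_m] := boolP (r < mdeg m)%N; last first.
    by rewrite (h'X m r_m) -mpolyXD lextX addmC.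
  rewrite {1 3}/h' r_m mdegD ltn_addr // hM; apply: eq_lext => u.
  by move=> /msupp_mulX[v /hN[_ v_m] ->]; rewrite /h' mdegD v_m ltn_addr.
Qed.

(* The quotients of the normal forms of the [x_0 m] extend the marked ideal one
   degree down. *)
Lemma marked_mtrunc_pred (A : comNzRingType) r (h : _ -> {mpoly A[n.+1]}) :
  marked (mtrunc r.+1 P) h ->
  (forall m u, P m -> mdeg m = r -> u \in msupp (h (m + U_(ord0))%MM) ->
     (0 < u ord0)%N) ->
  exists2 h', marked (mtrunc r P) h' &
    forall m, (r < mdeg m)%N -> h' m = h m.
Proof.
move=> mh div0; case: (mh) => hX hN hM; case: (sP) => PS _ P0.
pose h' m := if mtrunc r P m && (mdeg m == r) then
  quoX ord0 (h (m + U_(ord0))%MM) else h m.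
have h'E m : (r < mdeg m)%N -> h' m = h m.
  by move=> r_m; rewrite /h' (gtn_eqF r_m) andbF.
have h'X m : ~~ mtrunc r P m -> h' m = 'X_[m].
  move=> Nm; rewrite /h' (negPf Nm); apply: hX; apply: contra Nm.
  by rewrite /mtrunc => /andP[-> /ltnW].
have h'Q m : P m -> mdeg m = r ->
    h' m = quoX ord0 (h (m + U_(ord0))%MM) /\
    'X_ord0 * h' m = h (m + U_(ord0))%MM.
  move=> Pm r_m; rewrite /h' /mtrunc Pm r_m leqnn eqxx; split=> //.
  by apply: mulX_quoX => u; apply: div0.
have h'N m u : u \in msupp (h' m) -> ~~ mtrunc r P u /\ mdeg u = mdeg m.
  have [/andP[Pm r_m] | Nm] := boolP (mtrunc r P m); last first.
    by rewrite h'X // msuppX inE => /eqP ->.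
  have [m_r | m_r] := eqVneq (mdeg m) r.
    have [-> _] := h'Q _ Pm m_r; rewrite mcoeff_msupp mcoeff_quoX.
    rewrite -mcoeff_msupp => /hN[]; rewrite /mtrunc !mdegD mdeg1 m_r => Nu u_r.
    have ur : mdeg u = r by lia.
    split; rewrite // ur leqnn andbT.
    by move: Nu; rewrite ur addn1 leqnn andbT; apply: contra => /PS.
  have r_m' : (r < mdeg m)%N by rewrite ltn_neqAle eq_sym m_r.
  rewrite h'E // => /hN[]; rewrite /mtrunc => Nu u_m; split=> //.
  by move: Nu; rewrite u_m r_m r_m'.
exists h' => //; split=> // m i.
have [/andP[Pm r_m] | Nm] := boolP (mtrunc r P m); last first.
  by rewrite (h'X m) // -mpolyXD lextX addmC.
rewrite h'E ?mdegD ?mdeg1 ?addn1 //.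
have -> : lext h' ('X_i * h' m) = lext h ('X_i * h' m).
  apply: eq_lext => u /msupp_mulX[v /h'N[_ v_m] ->].
  by rewrite h'E // mdegD mdeg1 v_m addn1.
have [m_r | m_r] := eqVneq (mdeg m) r; last first.
  by rewrite hM h'E // ltn_neqAle eq_sym m_r.
(* In degree [r], [h' m] is controlled through its product with x_0, the normal form of x_0 m; so
   the identity is checked after multiplication by x_0. *)
have [_ Q] := h'Q _ Pm m_r; apply: (@mulXI _ _ ord0).
rewrite -(lext_mulX0 mh) => [|u /msupp_mulX[v /h'N[_ v_m] ->]]; last first.
  by rewrite mdegD mdeg1 v_m m_r addn1.
rewrite mulrCA Q -(lextX h (m + U_(ord0))%MM) -(lext_mulX mh) -mpolyXD.
have -> : (U_(i) + (m + U_(ord0)) = U_(ord0) + (m + U_(i)))%MM.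
  by rewrite addmC -addmA [RHS]addmC -addmA; congr (_ + _)%MM; rewrite addmC.
rewrite mpolyXD (lext_mulX0 mh) ?lextX // => u.
by rewrite msuppX inE => /eqP ->; rewrite mdegD mdeg1 m_r addn1.
Qed.

(* Multiplying the marked polynomial of [x_0 m] by [x_1] and reducing shows
   that [x_1] times the part of its tail not divisible by [x_0] is divisible by
   [x_0]. *)
Lemma marked_tail_div (A : comNzRingType) r (h : _ -> {mpoly A[n.+1]}) :
  marked (mtrunc r.+1 P) h ->
  (forall (i : 'I_n.+1) u, i = 1%N :> nat -> mdeg u = r.+1 -> u ord0 = 0%N ->
     ~~ P u -> ~~ P (u + U_(i))%MM) ->
  forall m u, P m -> mdeg m = r -> u \in msupp (h (m + U_(ord0))%MM) ->
    (0 < u ord0)%N.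
Proof.
move=> mh noX1 m u Pm m_r u_h; rewrite lt0n; apply/eqP => u0.
have deg_h v : v \in msupp (h (m + U_(ord0))%MM) -> ~~ P v /\ mdeg v = r.+1.
  by case/(marked_notin mh); rewrite mdegD mdeg1 m_r addn1.
have [_ u_r] := deg_h _ u_h.
(* If [n = 0], a monomial of positive degree is divisible by x_0, unlike [u]. *)
have n_gt0 : (1 < n.+1)%N.
  rewrite ltnS lt0n; apply/eqP => n0; move: u_r; rewrite mdegE.
  rewrite big1 // => -[i lt_i] _; rewrite -u0; congr (u _).
  by apply: val_inj => /=; lia.
pose i1 := Ordinal n_gt0; have i10 : (i1 == ord0) = false by [].
(* ['X_ord0 * q] collects the terms of [p] divisible by x_0; by hypothesis x_1 times the remaining
   terms is normal. *)
pose p := h (m + U_(ord0))%MM; pose q := quoX ord0 p.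
have p'E v : (p - 'X_ord0 * q)@_v = if (0 < v ord0)%N then 0 else p@_v.
  rewrite mcoeffB mcoeff_mulX; case: ifP => v0; last by rewrite subr0.
  by rewrite mcoeff_quoX submK ?subrr // lep1mP -lt0n.
have Np' : lext h ('X_i1 * (p - 'X_ord0 * q)) = 'X_i1 * (p - 'X_ord0 * q).
  apply: (lext_notin mh) => _ /msupp_mulX[v + ->]; rewrite mcoeff_msupp p'E.
  case: ifP => [_ /eqP // | /negbT]; rewrite -eqn0Ngt -mcoeff_msupp.
  by move=> /eqP v0 /deg_h[Nv v_r]; apply: noX1.
have := lext_mulX mh i1 'X_[m + U_(ord0)]; rewrite lextX -/p.
rewrite -{1}(subrK ('X_ord0 * q) p) mulrDr raddfD /= Np' mulrCA.
rewrite (lext_mulX0 mh) => [|v /msupp_mulX[w + ->]]; last first.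
  rewrite mcoeff_msupp mcoeff_quoX -mcoeff_msupp => /deg_h[_].
  by rewrite !mdegD !mdeg1 => ->.
rewrite addmC mpolyXD mulrCA (lext_mulX0 mh) => [|v]; last first.
  rewrite -mpolyXD msuppX inE => /eqP ->.
  by rewrite mdegD mdeg1 m_r.
(* The monomial x_1 u is free of x_0, so the multiples of x_0 on both sides do not contribute and
   the coefficient of [u] in [p] is 0. *)
move=> /(congr1 (mcoeff (u + U_(i1))%MM)).
rewrite mcoeffD !mcoeff_mulX !mnmDE !mnm1E eqxx i10 u0 addn1 /= addr0 addmK.
rewrite p'E u0 => /esym/eqP; rewrite mcoeff_eq0 => /negP; exact.
Qed.

End SatStable.

(** * A marked ideal that does not extend one degree down *)

Lemma exists_undivided n (P : pred 'X_{1..n.+1}) m :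
  P m -> exists2 g, P g & (mdeg g <= mdeg m)%N /\
    forall i, (0 < g i)%N -> ~~ P (g - U_(i))%MM.
Proof.
have [d] := ubnP (mdeg m); elim: d m => // d IHd m le_md Pm.
have [/existsP[i /andP[m_i Pmi]] | none] :=
    boolP [exists i, (0 < m i)%N && P (m - U_(i))%MM]; last first.
  exists m => //; split=> // i m_i; apply: contra none => Pmi.
  by apply/existsP; exists i; rewrite m_i.
have eq_m : (m - U_(i) + U_(i))%MM = m by rewrite submK // lep1mP -lt0n.
have mdeg_mi : (mdeg (m - U_(i))%MM).+1 = mdeg m.
  by rewrite -[in RHS]eq_m mdegD mdeg1 addn1.
have [|g Pg [g_m g_min]] := IHd _ _ Pmi; first by lia.
by exists g => //; split=> //; lia.
Qed.

(* With [g] a minimal generator of degree at most [r], and [b + e_i] one of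
   degree [r + 2] for [i = 1], the binomials [x_0^k x^g - x_0^l x^b] and the
   other monomials of the ideal in degrees greater than [r] span an ideal:
   [x^b] is killed by [x_1, ..., x_n] modulo the monomial ideal. *)
Lemma exists_marked_gap n (P : pred 'X_{1..n.+1}) (A : comNzRingType) r m0 b
    (i1 : 'I_n.+1) :
  sat_stable P -> P m0 -> mdeg m0 = r -> i1 = 1%N :> nat ->
  ~~ P b -> mdeg b = r.+1 -> b ord0 = 0%N -> P (b + U_(i1))%MM ->
  exists2 h : _ -> {mpoly A[n.+1]}, marked (mtrunc r.+1 P) h &
    exists m u, [/\ P m, mdeg m = r, u \in msupp (h (m + U_(ord0))%MM) &
      u ord0 = 0%N].
Proof.
case=> PS Pst P0 Pm0 m0_r i1E Nb b_r b0 Pb1.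
have [g Pg [g_m0 g_min]] := exists_undivided Pm0.
have g0 : g ord0 = 0%N.
  apply/eqP; rewrite -leqn0 leqNgt; apply/negP => g_gt0.
  move/negP: (g_min _ g_gt0); apply; apply: P0.
  by rewrite submK // lep1mP -lt0n.
pose ray (a : 'X_{1..n.+1}) e := (a + U_(ord0) *+ e)%MM.
have rayE a e i : ray a e i = (a i + (ord0 == i) * e)%N.
  by rewrite mnmDE mulmnE mnm1E.
have mdeg_ray a e : mdeg (ray a e) = (mdeg a + e)%N.
  by rewrite mdegD mdegMn mdeg1 mul1n.
have rayS a e : (ray a e + U_(ord0))%MM = ray a e.+1.
  by rewrite /ray mulmSr addmA.
have P_ray a e : P a -> P (ray a e).
  elim: e => [|e IHe] Pa; first by rewrite /ray mulm0n addm0.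
  by rewrite -rayS; apply/PS/IHe.
have N_ray a e : ~~ P a -> ~~ P (ray a e).
  move=> Na; elim: e => [|e IHe]; first by rewrite /ray mulm0n addm0.
  by rewrite -rayS; apply: contra IHe => /P0.
(* Strong stability trades x_1 for any later variable in x_1 x^b. *)
have Pbi (i : 'I_n.+1) : i != ord0 -> P (b + U_(i))%MM.
  move=> i0; have [-> // | ne_i1] := eqVneq i i1.
  have := Pst _ i i1 Pb1; rewrite mnmDE mnm1E eqxx addmK; apply; first lia.
  have : (i : nat) != 0%N by []. have : (i : nat) != i1 by [].
  by lia.
(* As x_0 does not divide x^g, the exponent of x_0 in [v] gives the only possible position on the
   ray. *)
pose on_g (v : 'X_{1..n.+1}) := v == ray g (v ord0).
pose h v : {mpoly A[n.+1]} :=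
  if mtrunc r.+1 P v then
    if on_g v then 'X_[ray b (mdeg v - r.+1)%N] else 0
  else 'X_[v].
have hX m : ~~ mtrunc r.+1 P m -> h m = 'X_[m] by rewrite /h => /negPf ->.
have hN m u : u \in msupp (h m) -> ~~ mtrunc r.+1 P u /\ mdeg u = mdeg m.
  rewrite /h; case: ifP => [/andP[Pm r_m] | Nm]; last first.
    by rewrite msuppX inE => /eqP ->; rewrite Nm.
  case: ifP => _; last by rewrite msupp0.
  rewrite msuppX inE => /eqP ->; rewrite /mtrunc (negPf (N_ray _ _ Nb)).
  by rewrite mdeg_ray b_r subnKC.
have h_off m : mtrunc r.+1 P m -> ~~ on_g m -> h m = 0.
  by rewrite /h => -> /negPf ->.
have mtruncS m i : mtrunc r.+1 P m -> mtrunc r.+1 P (m + U_(i))%MM.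
  by case/andP=> Pm r_m; rewrite /mtrunc PS // mdegD; lia.
have h0 m e : mtrunc r.+1 P m -> m = ray g e ->
    h m = 'X_[ray b (mdeg m - r.+1)%N].
  move=> Pm mE; rewrite /h Pm; case: ifP => // /negP[]; rewrite /on_g {2}mE.
  by rewrite rayE g0 eqxx mul1n /= mE.
exists h; last first.
  (* The power of x_0 brings x^g to degree [r]; with one more factor x_0 the normal form is
     [ray b 0], that is x^b. *)
  exists (ray g (r - mdeg g)%N), b; split=> //.
  - exact: P_ray.
  - by rewrite mdeg_ray; lia.
  rewrite rayS (h0 _ (r - mdeg g).+1%N) //; last first.
    by rewrite /mtrunc P_ray // mdeg_ray; lia.
  rewrite mdeg_ray (_ : (_ - _ = 0)%N) /ray ?mulm0n ?addm0 ?msuppX ?inE //.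
  lia.
split=> // m i; have [Pm | Nm] := boolP (mtrunc r.+1 P m); last first.
  by rewrite (hX m) // -mpolyXD lextX addmC.
(* A product x_i m on the ray forces [m] onto it when [i] is 0; otherwise [m] is a power of x_0
   times x^g / x_i, which is outside [P] by the choice of [g]. *)
have [m_g | m_g] := boolP (on_g m); last first.
  rewrite (h_off m) // mulr0 raddf0 h_off ?mtruncS //.
  apply: contra m_g => /eqP mi_g; apply/eqP.
  have mE j : (m j + (i == j) = g j + (ord0 == j) * (m ord0 + (i == ord0)))%N.
    by move/mnmP: mi_g => /(_ j); rewrite rayE !mnmDE !mnm1E.
  have [i0 | i0] := eqVneq i ord0.
    apply/mnmP => j; rewrite rayE; have := mE j; rewrite i0 eqxx.
    by case: (ord0 == j); lia.
  have gi : (0 < g i)%N.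
    by have := mE i; rewrite eqxx eq_sym (negPf i0); lia.
  case/negP: (N_ray _ (m ord0) (g_min _ gi)); have /andP[{}Pm _] := Pm.
  suff <- : m = ray (g - U_(i))%MM (m ord0) by [].
  apply/mnmP => j; rewrite rayE mnmBE mnm1E; have := mE j.
  rewrite (negPf i0); case: (eqVneq i j) => [<- | _]; last by lia.
  by rewrite eq_sym (negPf i0); lia.
have r_m : (r < mdeg m)%N by case/andP: Pm.
move/eqP: (m_g) => mE; rewrite (h0 m (m ord0)) // -mpolyXD lextX.
have [-> | i0] := eqVneq i ord0.
  rewrite [(U_(ord0) + _)%MM]addmC rayS (hX (ray _ _)).
    rewrite (h0 _ (m ord0).+1) ?mtruncS //; last by rewrite -rayS -mE.
    by rewrite mdegD mdeg1 addn1 subSn.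
  by rewrite /mtrunc (negPf (N_ray _ _ Nb)).
(* Both sides vanish: x_i m leaves the ray of [g], while x_i x^b lies in [P] and its multiples by
   powers of x_0 are off that ray, since its degree [r + 2] exceeds that of [g]. *)
rewrite !h_off ?mtruncS //.
- rewrite /mtrunc (_ : (_ + _ = ray (b + U_(i)) (mdeg m - r.+1)%N)%MM).
    by rewrite P_ray ?Pbi // mdeg_ray mdegD; lia.
  by rewrite addmC /ray -!addmA; congr (_ + _)%MM; rewrite addmC.
- apply/negP => /eqP /(congr1 (@mdeg _)).
  by rewrite !mdeg_ray mdegD mdeg1 mdeg_ray mnmDE mnm1E (negPf i0) rayE b0 eqxx; lia.
- apply/negP => /eqP /mnmP /(_ i); rewrite rayE !mnmDE !mnm1E eqxx.
  by move/mnmP: mE => /(_ i); rewrite rayE eq_sym (negPf i0); lia.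
Qed.

(** * Monomials of a saturated strongly stable ideal over the integers *)

Definition mon n (J : {mpoly int[n.+1]} -> Prop) : pred 'X_{1..n.+1} :=
  fun m => if excluded_middle_informative (J 'X_[m]) then true else false.

Lemma monP n (J : {mpoly int[n.+1]} -> Prop) m : J 'X_[m] <-> mon J m.
Proof. by rewrite /mon; case: excluded_middle_informative. Qed.

Arguments monP : clear implicits.

Lemma truncge_monP n (J : {mpoly int[n.+1]} -> Prop) s m :
  truncge s J 'X_[m] <-> mtrunc s (mon J) m.
Proof.
rewrite truncgeP (monP n J); split=> [[Jm s_m] | /andP[Jm s_m]].
  by rewrite /mtrunc Jm s_m // msuppX mem_head.
by split=> // u; rewrite msuppX inE => /eqP ->.
Qed.

Lemma monomial_ideal_msupp n (J : {mpoly int[n.+1]} -> Prop) f m u :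
  monomial_ideal J -> J f -> m \in msupp f -> J 'X_[(m + u)%MM].
Proof.
case=> M JM /JM[k [c [e [He ->]]]].
move=> /msupp_sum_le /flattenP[_ /mapP[i _ ->]].
have [v Mv ->] := He i; rewrite [_ *: _]/(_ * _) (perm_mem (msuppMX _ _)).
case/mapP => w _ ->; apply/JM.
exists 1%N, (fun=> 'X_[(w + u)%MM]), (fun=> 'X_[v]).
split=> [_|]; first by exists v.
rewrite big_ord1 (_ : _ + u = w + u + v)%MM; first exact: mpolyXD.
by rewrite -addmA addmC.
Qed.

(** For the last clause, strong stability turns x_0 x^m in [J] into x_i x^m in [J] for every [i],
    and saturation applies with exponent 1. *)
Lemma mon_sat_stable n (J : {mpoly int[n.+1]} -> Prop) :
  strongly_stable J -> saturated J -> sat_stable (mon J).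
Proof.
case=> mJ stJ satJ; split=> [m i|m i j|m].
- move=> /(monP n J) Jm; apply/(monP n J); apply: monomial_ideal_msupp mJ Jm _.
  by rewrite msuppX mem_head.
- by move=> /(monP n J) Jm m_j ji; apply/(monP n J)/stJ.
move=> /(monP n J) Jm; apply/(monP n J)/satJ.
exists 1%N => u /eqP/mdeg1P[i /eqP ->].
rewrite -mpolyXD; have [-> | i0] := eqVneq i ord0; first by rewrite addmC.
have := stJ _ i ord0 Jm; rewrite mnmDE mnm1E eqxx addn1 addmK addmC.
by apply; rewrite // lt0n.
Qed.

(** * Marked functors of the truncations: inclusion and closedness *)

Section MarkedFunctors.
Variables (n : nat) (J : {mpoly int[n.+1]} -> Prop).
Hypotheses (hJ : strongly_stable J) (hsat : saturated J).

Let sP : sat_stable (mon J) := mon_sat_stable hJ hsat.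

Lemma Mf_truncgeP s (A : comNzRingType) (I : {mpoly A[n.+1]} -> Prop) :
  Mf (truncge s J) I <->
  exists2 h, marked (mtrunc s (mon J)) h & forall f, I f <-> lext h f = 0.
Proof. exact/MfP/truncge_monP. Qed.

(** If [I'] represents the same subscheme, its normal forms agree with [h] above degree [r], and
    there that of x_0 m is x_0 times that of [m]. The converse divides by x_0. *)
Lemma proj_mem_MfP r (A : comNzRingType) (I : {mpoly A[n.+1]} -> Prop) h :
  marked (mtrunc r.+1 (mon J)) h -> (forall f, I f <-> lext h f = 0) ->
  proj_mem (Mf (truncge r J)) I <->
  forall m u, mon J m -> mdeg m = r -> u \in msupp (h (m + U_(ord0))%MM) ->
    (0 < u ord0)%N.
Proof.
move=> mh Ih; split=> [[I' /Mf_truncgeP[h' mh' Ih'] II'] m u Jm m_r | div0].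
  move/(same_proj_nf sP mh Ih mh' Ih'): II' => ->; last first.
    by rewrite mdegD mdeg1 m_r addn1 geq_max leqnn leqnSn.
  rewrite -lextX addmC mpolyXD (lext_mulX0 sP mh').
    by case/msupp_mulX => v _ ->; rewrite mnmDE mnm1E eqxx addn1.
  by move=> v; rewrite msuppX inE => /eqP ->; rewrite m_r.
have [h' mh' hh'] := marked_mtrunc_pred sP mh div0.
exists (fun f => lext h' f = 0); first by apply/Mf_truncgeP; exists h'.
apply/(same_proj_nf sP mh Ih mh') => // m.
by rewrite geq_max => /andP[r_m _]; rewrite hh'.
Qed.

Lemma included_Mf_truncgeS r (A : comNzRingType) :
  included (Mf (truncge r J)) (Mf (truncge r.+1 J)) A.
Proof.
move=> I /Mf_truncgeP[h mh Ih]; have mh' := marked_mtruncS mh.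
set h' := (fun m => _) in mh'; exists (fun f => lext h' f = 0).
  by apply/Mf_truncgeP; exists h'.
apply/(same_proj_nf sP mh Ih mh') => // m.
by rewrite geq_max => /andP[_ r_m]; rewrite /h' r_m.
Qed.

Lemma subfunctor_Mf_truncge a b :
  (forall A, noetherian A ->
     included (Mf (truncge a J)) (Mf (truncge b J)) A) ->
  subfunctor (Mf (truncge a J)) (Mf (truncge b J)).
Proof.
move=> inc A nA; split=> [|B phi _]; first exact: inc.
split=> [I /Mf_truncgeP[h mh Ih] | I I'].
  apply/Mf_truncgeP; exists (fun m => map_mpoly phi (h m)).
    exact: marked_map.
  by move=> f; apply: (base_changeP phi mh Ih f).
move=> /Mf_truncgeP[h mh Ih] /Mf_truncgeP[h' mh' Ih'].
move=> /(same_proj_nf sP mh Ih mh' Ih') hh'.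
apply/(same_proj_nf sP (marked_map phi mh) (base_changeP phi mh Ih)
  (marked_map phi mh') (base_changeP phi mh' Ih')) => m le_m.
by rewrite hh'.
Qed.

Lemma closed_subfunctor_Mf r :
  closed_subfunctor (Mf (truncge r J)) (Mf (truncge r.+1 J)).
Proof.
split=> [|A nA I /Mf_truncgeP[h mh Ih]].
  by apply: subfunctor_Mf_truncge => A _; apply: included_Mf_truncgeS.
(* The obstructions are the coefficients of the normal forms of the x_0 m at monomials free of
   x_0. *)
pose obs (x : A) := exists m u : 'X_{1..n.+1},
  [/\ mon J m, mdeg m = r, u ord0 = 0%N &
  x = (h (m + U_(ord0))%MM)@_u].
(* The ideal generated by the obstructions, as the intersection of all ideals containing them; the
   kernel of [phi] is one of the [K] to test. *)
exists (fun x => forall K : A -> Prop, is_ideal K ->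
    (forall y, obs y -> K y) -> K x).
  split=> [K [] // | x y Ix Iy K iK oK | a x Ix K iK oK].
    by case: (iK) => _ KD _; apply: KD; [apply: Ix | apply: Iy].
  by case: (iK) => _ _ KM; apply: KM; apply: Ix.
move=> B phi _.
rewrite (proj_mem_MfP (marked_map phi mh) (base_changeP phi mh Ih)).
split=> [div0 x /(_ (fun y => phi y = 0)) | a0 m u Jm m_r].
  apply.
    split=> [|y z y0 z0|c y y0]; first exact: raddf0.
      by rewrite raddfD /= y0 z0 addr0.
    by rewrite rmorphM /= y0 mulr0.
  move=> _ [m [u [Jm m_r u0 ->]]]; rewrite -mcoeff_map_mpoly.
  apply/eqP; rewrite mcoeff_eq0; apply/negP => u_h.
  by have := div0 _ _ Jm m_r u_h; rewrite u0.
rewrite mcoeff_msupp mcoeff_map_mpoly lt0n; apply: contra => /eqP u0.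
by apply/eqP; apply: a0 => K _; apply; exists m, u.
Qed.

(** Used by contraposition: distinct truncations yield a monomial of degree [r] in [J]. *)
Lemma no_truncge_gap r :
  (forall m, mon J m -> mdeg m <> r) ->
  forall f, truncge r J f <-> truncge r.+1 J f.
Proof.
move=> none f; rewrite !truncgeP; split=> -[Jf tf]; split=> // u u_f.
  have r_u := tf u u_f; have := none u; rewrite ltn_neqAle r_u andbT.
  move=> /(_ _)/eqP; rewrite eq_sym; apply.
  apply/(monP n J); rewrite -[u]addm0.
  exact: monomial_ideal_msupp (hJ.1) Jf u_f.
by rewrite ltnW // tf.
Qed.

End MarkedFunctors.

(** * A test ring for properness, and the two cases of the theorem *)

Lemma field_noetherian (F : fieldType) : noetherian F.
Proof.
move=> I [I0 _ IM].
have [[x Ix x0] | none] := classic (exists2 x, I x & x != 0).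
  exists [:: 1] => y; split=> _.
    exists 1%N, (fun=> y), (fun=> 1); split=> [_|]; first exact: mem_head.
    by rewrite big_ord1 [RHS]mulr1.
  by rewrite -[y](divfK x0); apply: IM.
exists [::] => y; split=> [Iy | [k [c [e [He ->]]]]].
  exists 0%N, (fun=> 0), (fun=> 0); split=> [[]//|]; rewrite big_ord0.
  by apply: NNPP => /eqP y0; apply: none; exists y.
by case: k c e He => [|k] c e He; [rewrite big_ord0 | have := He ord0].
Qed.

Theorem theorem3p4 (n : nat) (J : {mpoly int[n.+1]} -> Prop)
    (hJ : strongly_stable J) (hsat : saturated J) (s : nat) (hs : (0 < s)%N) :
  (forall A : comNzRingType, noetherian A ->
     included (Mf (truncge s.-1 J)) (Mf (truncge s J)) A) /\
  ((~ has_x1_generator J s.+1 \/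
      (forall f, truncge s.-1 J f <-> truncge s J f)) ->
     eq_functor (Mf (truncge s.-1 J)) (Mf (truncge s J))) /\
  (~ (~ has_x1_generator J s.+1 \/
      (forall f, truncge s.-1 J f <-> truncge s J f)) ->
     proper_closed_subfunctor (Mf (truncge s.-1 J)) (Mf (truncge s J))).
Proof.
case: s hs => // r _; rewrite succnK.
have sP := mon_sat_stable hJ hsat; have [PS Pst P0] := sP.
have inc A : included (Mf (truncge r J)) (Mf (truncge r.+1 J)) A.
  exact: included_Mf_truncgeS.
split=> [A _ | ]; first exact: inc.
split=> [noX1 | /not_or_and[/NNPP[beta [bmin b_r [i1 i1E b_i1]]] noE]].
  split; apply: subfunctor_Mf_truncge => // A _ I.
  move=> /Mf_truncgeP[h mh Ih]; apply/(proj_mem_MfP hJ hsat mh Ih).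
  case: noX1 => [noX1 | trE] m u Jm m_r; last first.
    have /trE/truncge_monP : truncge r J 'X_[m].
      by apply/truncge_monP; rewrite /mtrunc Jm m_r leqnn.
    by rewrite /mtrunc m_r ltnn andbF.
  (* If x_1 v lay in [J] with v outside, it would be a minimal generator of degree [r + 2], contrary
     to [noX1]. *)
  apply: (marked_tail_div sP mh) => // i v i1 v_r v0 Nv.
  apply/negP => Jvi; apply: noX1; exists (v + U_(i))%MM; split; last first.
  - by exists i => //; rewrite mnmDE mnm1E eqxx addn1.
  - by rewrite mdegD mdeg1 v_r addn1.
  split=> [|w w_v Jw]; first exact/(monP n J).
  apply: NNPP => ne_w; case/negP: (Nv).
  (* A proper divisor [w] in [J] allows some x_j to be divided out of x_1 v inside [J]. Here [j] is
     not 0, [j = i] puts [v] in [J], and a larger [j] does so by exchanging x_1 for x_j. *)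
  have [j lt_j] : exists j, (w j < (v + U_(i))%MM j)%N.
    apply: NNPP => none; apply: ne_w; apply/mnmP => j; apply/eqP.
    rewrite eqn_leq (mnm_lepP w_v) leqNgt; apply/negP => lt_j.
    by apply: none; exists j.
  have eq_vi : (v + U_(i) - U_(j) + U_(j) = v + U_(i))%MM.
    by rewrite submK // lep1mP -lt0n; apply: leq_trans lt_j.
  have Jvij : mon J (v + U_(i) - U_(j))%MM.
    have w_vij : (w <= v + U_(i) - U_(j))%MM.
      apply/mnm_lepP => l; have := mnm_lepP w_v l.
      rewrite [X in _ -> (_ <= X)%N]mnmBE mnm1E.
      by case: (eqVneq j l) => [<-|_]; lia.
    rewrite -(submK w_vij) addmC; apply/(monP n J).
    by apply: monomial_ideal_msupp hJ.1 Jw _; rewrite msuppX mem_head.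
  have [ji | ne_ji] := eqVneq j i; first by rewrite ji addmK in Jvij.
  have j_gt1 : (i < j)%N.
    have : (j : nat) != i by [].
    suff : (j : nat) != 0%N by lia.
    apply: contraTneq lt_j => j0; have -> : j = ord0 by apply: val_inj.
    by rewrite mnmDE mnm1E v0 -leqNgt; case: eqP i1 => // ->.
  have := Pst _ j i Jvij _ j_gt1; rewrite mnmBE mnmDE !mnm1E eqxx.
  rewrite (negPf ne_ji) subn0 addn1 => /(_ isT).
  suff -> : (v + U_(i) - U_(j) - U_(i) + U_(j) = v)%MM by [].
  by rewrite submDA [(U_(j) + _)%MM]addmC -submDA addmK submK // lep1mP -lt0n;
    move: lt_j; rewrite mnmDE mnm1E eq_sym (negPf ne_ji) addn0; case: (v j).
have bmin' i : (0 < beta i)%N -> ~~ mon J (beta - U_(i))%MM.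
  move=> b_i; apply/negP => /(monP n J) Jb; have := bmin.2 _ (lem_subr _ _) Jb.
  move=> /mnmP /(_ i); rewrite mnmBE mnm1E eqxx; lia.
have [m [Jm m_r]] : exists m, mon J m /\ mdeg m = r.
  apply: NNPP => none; apply: noE; apply: no_truncge_gap => // m Jm m_r.
  by apply: none; exists m.
have b_E : (beta - U_(i1) + U_(i1) = beta)%MM by rewrite submK // lep1mP -lt0n.
have beta0 : beta ord0 = 0%N.
  apply/eqP; rewrite -leqn0 leqNgt; apply/negP => b_gt0.
  case/negP: (bmin' _ b_gt0); apply: P0.
  by rewrite submK ?lep1mP -?lt0n //; apply/(monP n J)/bmin.1.
(* The monomial [beta] / x_1 serves as [b]: it is outside [J] by minimality, and free of x_0 because
   [beta] is. *)
have [||||h mh [m' [u [Jm' m'_r u_h u0]]]] :=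
    @exists_marked_gap _ _ rat _ _ (beta - U_(i1))%MM _ sP Jm m_r i1E.
- exact: bmin'.
- by move: b_r; rewrite -[in mdeg _]b_E mdegD mdeg1; lia.
- by rewrite mnmBE beta0.
- by rewrite b_E; apply/(monP n J)/bmin.1.
split; first exact: closed_subfunctor_Mf.
exists rat; first exact: field_noetherian.
move=> /(_ (fun f => lext h f = 0)) [|I' II' sI'].
  by apply/Mf_truncgeP; exists h.
have /(proj_mem_MfP hJ hsat mh) :
    proj_mem (Mf (truncge r J)) (fun f => lext h f = 0).
  by exists I'.
by move=> /(_ (fun=> iff_refl _) _ _ Jm' m'_r u_h); rewrite u0.
Qed.
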